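(* Let $f\colon\mathbf{R}^n\to\mathbf{R}\cup\{-\infty,+\infty\}$ be a lower-semicontinuous function, let $\bar{x}$ be a local minimizer of $f$, and suppose that $f$ is subdifferentially continuous at $\bar{x}$ for $0$. Then the following are equivalent. 1. The limiting subdifferential mapping $\partial f$ is strongly metrically regular at $\bar{x}$ for $0$. 2. $f$ is prox-regular at $\bar{x}$ for $0$ and $\bar{x}$ gives a tilt-stable local minimum of $f$. 3. There exist $\kappa>0$ and neighbourhoods $U$ of $\bar{x}$ and $V$ of $0$ so that the localization of $(\partial f)^{-1}$ relative to $V$ and $U$ is single-valued (i.e. for every $v\in V$ there is exactly one $x\in U$ with $v\in\partial f(x)$) and $$f(x)\geq f(\tilde{x})+\langle \tilde{v},x-\tilde{x}\rangle+\kappa |x-\tilde{x}|^2\quad \text{for all } x\in U$$ and for all $(\tilde{x},\tilde{v})\in (U\times V)\cap\operatorname{gph}\partial f$. 4. $f$ is prox-regular at $\bar{x}$ for $0$ and $\bar{x}$ is a stable strong local minimizer of $f$.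
   Context: $|\cdot|$ is the Euclidean norm on $\mathbf{R}^n$, $\langle\cdot,\cdot\rangle$ the standard inner product, and $\mathbf{B}_\epsilon(\bar{x})$ the open ball of radius $\epsilon$ around $\bar{x}$. Subdifferentials. For $f\colon\mathbf{R}^n\to\mathbf{R}\cup\{\pm\infty\}$ and a point $\bar{x}$ with $f(\bar{x})$ finite, the proximal subdifferential $\partial_P f(\bar{x})$ consists of all $v\in\mathbf{R}^n$ for which there exists $r>0$ with $f(x)\geq f(\bar{x})+\langle v,x-\bar{x}\rangle-r|x-\bar{x}|^2$ for all $x$ near $\bar{x}$. The limiting subdifferential $\partial f(\bar{x})$ consists of all $v$ for which there exists a sequence $(x_i,f(x_i),v_i)\to(\bar{x},f(\bar{x}),v)$ with $v_i\in\partial_P f(x_i)$ for each $i$. (Subdifferentials are empty at points where $f$ is not finite.) The graph is $\operatorname{gph}\partial f=\{(x,v): v\in\partial f(x)\}$, and $(\partial f)^{-1}(v)=\{x: v\in\partial f(x)\}$. Localization. For a set-valued mapping $F\colon\mathbf{R}^n\rightrightarrows\mathbf{R}^m$ and neighbourhoods $U\subset\mathbf{R}^n$, $V\subset\mathbf{R}^m$, the localization of $F$ relative to $U$ and $V$ is the set-valued mapping whose graph is $(U\times V)\cap\operatorname{gph}F$. Strong metric regularity. $F$ is strongly metrically regular at $\bar{x}$ for $\bar{v}$, where $\bar{v}\in F(\bar{x})$, if there exist neighbourhoods $U$ of $\bar{x}$ and $V$ of $\bar{v}$ so that the localization of $F^{-1}$ relative to $V$ and $U$ defines a single-valued Lipschitz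 continuous mapping (on $V$). Prox-regularity. $f$ is prox-regular at $\bar{x}$ for $\bar{v}$ if $f$ is finite and locally lower-semicontinuous at $\bar{x}$ with $\bar{v}\in\partial f(\bar{x})$, and there exist $\epsilon>0$ and $\rho\geq 0$ such that $f(x')\geq f(x)+\langle v,x'-x\rangle-\frac{\rho}{2}|x'-x|^2$ for all $x'\in\mathbf{B}_\epsilon(\bar{x})$ whenever $v\in\partial f(x)$, $|v-\bar{v}|<\epsilon$, $|x-\bar{x}|<\epsilon$, $|f(x)-f(\bar{x})|<\epsilon$. Subdifferential continuity. $f$ is subdifferentially continuous at $\bar{x}$ for $\bar{v}\in\partial f(\bar{x})$ if for any sequences $x_i\to\bar{x}$ and $v_i\to\bar{v}$ with $v_i\in\partial f(x_i)$, one has $f(x_i)\to f(\bar{x})$. Tilt stability. $\bar{x}$ gives a tilt-stable local minimum of $f$ if $f(\bar{x})$ is finite and there exists $\epsilon>0$ such that the mapping $M\colon v\mapsto\operatorname{argmin}_{|x-\bar{x}|\leq\epsilon}\{f(x)-\langle v,x\rangle\}$ is single-valued and Lipschitz on some neighbourhood of $0$ with $M(0)=\bar{x}$. Stable strong local minimizer. $\bar{x}$, with $f(\bar{x})$ finite, is a stable strong local minimizer of $f$ if there are a constant $\kappa>0$ and a neighbourhood $U$ of $\bar{x}$ so that for each vector $v$ near the origin there is a (necessarily unique) point $x_v\in U$, with $x_0=\bar{x}$, so that, with $f_v(x):=f(x)-\langle v,x\rangle$, the inequality $f_v(x)\geq f_v(x_v)+\kappa|x-x_v|^2$ holds for each $x\in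 U$. *)

(* Defs.v *)
From HB Require Import structures.
From mathcomp Require Import all_boot all_order all_algebra.
From mathcomp Require Import all_classical all_reals all_analysis.
Set Implicit Arguments.
Unset Strict Implicit.
Unset Printing Implicit Defensive.
Import Order.TTheory GRing.Theory Num.Theory.
Import numFieldNormedType.Exports.
Local Open Scope classical_set_scope.
Local Open Scope ring_scope.

(* The library norm on 'rV[R]_n is the sup norm. Neighbourhoods and limits use
   the library topology of 'rV[R]_n, which is also the Euclidean one; every
   quantitative bound uses enorm. *)
Definition dotp (R : realType) (n : nat) (u v : 'rV[R]_n) : R :=
  \sum_(i < n) u 0 i * v 0 i.

Definition enorm (R : realType) (n : nat) (u : 'rV[R]_n) : R :=
  Num.sqrt (dotp u u).

(* A set-valued mapping F is a function into sets; (x, v) lies in its graph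
   iff F x v. *)
Definition inverse_map (X Y : Type) (F : X -> set Y) : Y -> set X :=
  fun y => [set x | F x y].

Definition localization (X Y : Type) (F : X -> set Y) (U : set X) (V : set Y) :
  X -> set Y := fun x => [set y | [/\ U x, V y & F x y]].

Definition single_valued_on (X Y : Type) (U : set X) (F : X -> set Y) : Prop :=
  forall x, U x -> exists! y, F x y.

Definition lipschitz_map_on (R : realType) (n m : nat) (U : set 'rV[R]_n)
    (F : 'rV[R]_n -> set 'rV[R]_m) : Prop :=
  single_valued_on U F /\
  exists L : R, forall x x' y y', U x -> U x' -> F x y -> F x' y' ->
    enorm (y - y') <= L * enorm (x - x').

Definition strongly_metrically_regular (R : realType) (n m : nat)
    (F : 'rV[R]_n -> set 'rV[R]_m) (xbar : 'rV[R]_n) (vbar : 'rV[R]_m) : Prop :=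
  F xbar vbar /\
  exists (U : set 'rV[R]_n) (V : set 'rV[R]_m),
    [/\ nbhs xbar U, nbhs vbar V &
        lipschitz_map_on V (localization (inverse_map F) V U)].

Definition local_minimizer (R : realType) (n : nat) (f : 'rV[R]_n -> \bar R)
    (xbar : 'rV[R]_n) : Prop :=
  \forall x \near xbar, (f xbar <= f x)%E.

Definition prox_subdiff (R : realType) (n : nat) (f : 'rV[R]_n -> \bar R)
    (xbar : 'rV[R]_n) : set 'rV[R]_n :=
  [set v | f xbar \is a fin_num /\
    exists2 r : R, 0 < r &
      \forall x \near xbar,
        (f x >= f xbar + (dotp v (x - xbar))%:E
                - (r * enorm (x - xbar) ^+ 2)%:E)%E].

Definition lim_subdiff (R : realType) (n : nat) (f : 'rV[R]_n -> \bar R)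
    (xbar : 'rV[R]_n) : set 'rV[R]_n :=
  [set v | f xbar \is a fin_num /\
    exists x_ v_ : nat -> 'rV[R]_n,
      [/\ x_ @ \oo --> xbar, (f \o x_) @ \oo --> f xbar, v_ @ \oo --> v &
          forall i, prox_subdiff f (x_ i) (v_ i)]].

(* Local lower semicontinuity in the sense of Rockafellar and Wets: the
   truncations to a closed ball of the sublevel sets of height at most
   f xbar + e are closed. *)
Definition locally_lsc (R : realType) (n : nat) (f : 'rV[R]_n -> \bar R)
    (xbar : 'rV[R]_n) : Prop :=
  exists2 e : R, 0 < e &
    forall a : R, (a%:E <= f xbar + e%:E)%E ->
      closed [set x | enorm (x - xbar) <= e /\ (f x <= a%:E)%E].

Definition prox_regular (R : realType) (n : nat) (f : 'rV[R]_n -> \bar R)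
    (xbar vbar : 'rV[R]_n) : Prop :=
  [/\ f xbar \is a fin_num, locally_lsc f xbar, lim_subdiff f xbar vbar &
      exists eps rho : R,
        [/\ 0 < eps, 0 <= rho &
            forall x v, lim_subdiff f x v ->
              enorm (v - vbar) < eps -> enorm (x - xbar) < eps ->
              (`|f x - f xbar| < eps%:E)%E ->
              forall x' : 'rV[R]_n, enorm (x' - xbar) < eps ->
                (f x' >= f x + (dotp v (x' - x))%:E
                         - (rho / 2 * enorm (x' - x) ^+ 2)%:E)%E]].

Definition subdiff_continuous (R : realType) (n : nat) (f : 'rV[R]_n -> \bar R)
    (xbar vbar : 'rV[R]_n) : Prop :=
  lim_subdiff f xbar vbar /\
  forall x_ v_ : nat -> 'rV[R]_n,
    x_ @ \oo --> xbar -> v_ @ \oo --> vbar ->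
    (forall i, lim_subdiff f (x_ i) (v_ i)) ->
    (f \o x_) @ \oo --> f xbar.

Definition tilt (R : realType) (n : nat) (f : 'rV[R]_n -> \bar R)
    (v : 'rV[R]_n) : 'rV[R]_n -> \bar R :=
  fun x => (f x - (dotp v x)%:E)%E.

Definition argmin_on (R : realType) (X : Type) (A : set X) (g : X -> \bar R) :
  set X := [set x | A x /\ forall y, A y -> (g x <= g y)%E].

Definition tilt_stable (R : realType) (n : nat) (f : 'rV[R]_n -> \bar R)
    (xbar : 'rV[R]_n) : Prop :=
  f xbar \is a fin_num /\
  exists2 eps : R, 0 < eps &
    let M := fun v => argmin_on [set x | enorm (x - xbar) <= eps] (tilt f v) in
    M 0 = [set xbar] /\
    exists2 V : set 'rV[R]_n, nbhs (0 : 'rV[R]_n) V & lipschitz_map_on V M.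

Definition stable_strong_local_minimizer (R : realType) (n : nat)
    (f : 'rV[R]_n -> \bar R) (xbar : 'rV[R]_n) : Prop :=
  f xbar \is a fin_num /\
  exists (kappa : R) (U : set 'rV[R]_n),
    [/\ 0 < kappa, nbhs xbar U &
        exists x_ : 'rV[R]_n -> 'rV[R]_n,
          x_ 0 = xbar /\
          \forall v \near (0 : 'rV[R]_n),
            U (x_ v) /\
            forall x, U x ->
              (tilt f v x >= tilt f v (x_ v)
                             + (kappa * enorm (x - x_ v) ^+ 2)%:E)%E].

(* Main.v *)
(* Both tilt stability and the stable strong minimizer property give a Lipschitz
   map v |-> m v with f x >= f (m v) + <v, x - m v> near xbar and v in the
   subdifferential of f at m v; the quadratic term is free, because comparing
   the supporting inequalities at v and at v + t (x - m v) bounds f below by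
   f (m v) + <v, x - m v> + k |x - m v|^2. That v is a subgradient at no other
   point near xbar is a maximality argument: prox-regularity makes the
   subdifferential hypomonotone near (xbar, 0), whereas m, a monotone Lipschitz
   map, has an inverse that is locally maximal monotone. Conversely, strong
   metric regularity forces xbar to be a strict local minimizer, so by
   compactness the tilted functions have interior minimizers on a small ball;
   these are critical points, hence the only ones nearby, and f is supported at
   every subgradient near (xbar, 0). *)
Require Import Defs.
From HB Require Import structures.
From mathcomp Require Import all_boot all_order all_algebra.
From mathcomp Require Import all_classical all_reals all_analysis.
From mathcomp Require Import ring lra.
Set Implicit Arguments.
Unset Strict Implicit.
Unset Printing Implicit Defensive.
Import Order.TTheory GRing.Theory Num.Theory.
Import numFieldNormedType.Exports.
Local Open Scope classical_set_scope.
Local Open Scope ring_scope.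

(** * The Euclidean norm and its topology *)

Section euclidean.
Context {R : realType} {n : nat}.
Implicit Types (u v w x y : 'rV[R]_n) (U : set 'rV[R]_n) (a e r : R).

Lemma dotpC u v : dotp u v = dotp v u.
Proof. by apply: eq_bigr => i _; rewrite mulrC. Qed.

Lemma dotpDl u v w : dotp (u + v) w = dotp u w + dotp v w.
Proof.
by rewrite /dotp -big_split; apply: eq_bigr => i _; rewrite mxE mulrDl.
Qed.

Lemma dotpZl a u v : dotp (a *: u) v = a * dotp u v.
Proof.
by rewrite /dotp mulr_sumr; apply: eq_bigr => i _; rewrite mxE mulrA.
Qed.

Lemma dotpNl u v : dotp (- u) v = - dotp u v.
Proof. by rewrite -scaleN1r dotpZl mulN1r. Qed.

Lemma dotpDr u v w : dotp u (v + w) = dotp u v + dotp u w.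
Proof. by rewrite dotpC dotpDl !(dotpC u). Qed.

Lemma dotpZr a u v : dotp u (a *: v) = a * dotp u v.
Proof. by rewrite dotpC dotpZl dotpC. Qed.

Lemma dotpNr u v : dotp u (- v) = - dotp u v.
Proof. by rewrite dotpC dotpNl dotpC. Qed.

Lemma dotp0l v : dotp 0 v = 0.
Proof. by rewrite -(scale0r 0) dotpZl mul0r. Qed.

Definition dotpE := (dotpDl, dotpDr, dotpZl, dotpZr, dotpNl, dotpNr).

Lemma dotp_ge0 u : 0 <= dotp u u.
Proof. by apply: sumr_ge0 => i _; rewrite -expr2 sqr_ge0. Qed.

Lemma sqr_enorm u : enorm u ^+ 2 = dotp u u.
Proof. by rewrite sqr_sqrtr // dotp_ge0. Qed.

Lemma enorm_ge0 u : 0 <= enorm u.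
Proof. exact: sqrtr_ge0. Qed.

Lemma enorm0 : enorm (0 : 'rV[R]_n) = 0.
Proof. by rewrite /enorm dotp0l sqrtr0. Qed.

Lemma enormZ a u : enorm (a *: u) = `|a| * enorm u.
Proof.
rewrite /enorm dotpZl dotpZr mulrA -expr2 sqrtrM ?sqr_ge0//.
by rewrite sqrtr_sqr.
Qed.

Lemma enormN u : enorm (- u) = enorm u.
Proof. by rewrite /enorm dotpNl dotpNr opprK. Qed.

Lemma enormB u v : enorm (u - v) = enorm (v - u).
Proof. by rewrite -enormN opprB. Qed.

Lemma le_coord_enorm u i : `|u 0 i| <= enorm u.
Proof.
rewrite -sqrtr_sqr ler_wsqrtr// /dotp (bigD1 i)//= expr2 lerDl.
by apply: sumr_ge0 => j _; rewrite -expr2 sqr_ge0.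
Qed.

Lemma enorm_eq0 u : enorm u = 0 -> u = 0.
Proof.
move=> u0; apply/rowP => i; rewrite mxE; apply/eqP.
by rewrite -normr_le0 -u0 le_coord_enorm.
Qed.

Lemma dotp_le_enorm u v : dotp u v <= enorm u * enorm v.
Proof.
have [/enorm_eq0 ->|u0] := eqVneq (enorm u) 0.
  by rewrite dotp0l enorm0 mul0r.
have [/enorm_eq0 ->|v0] := eqVneq (enorm v) 0.
  by rewrite dotpC dotp0l enorm0 mulr0.
have uv : 0 < enorm u * enorm v by rewrite mulr_gt0// lt0r ?u0 ?v0 enorm_ge0.
(* Cauchy-Schwarz: expand the squared norm of this vector and divide by |u| |v|. *)
have := dotp_ge0 (enorm v *: u - enorm u *: v).
rewrite !dotpE -!sqr_enorm (dotpC v u) => ?.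
rewrite -(ler_pM2l uv); lra.
Qed.

Lemma ler_enormD u v : enorm (u + v) <= enorm u + enorm v.
Proof.
rewrite -(@ler_pXn2r _ 2)// ?nnegrE ?addr_ge0 ?enorm_ge0//.
have := dotp_le_enorm u v; rewrite sqrrD !sqr_enorm !dotpE (dotpC v u); lra.
Qed.

Lemma ler_enormB u v : enorm (u - v) <= enorm u + enorm v.
Proof. by rewrite -(enormN v) ler_enormD. Qed.

Lemma ler_enorm_dist w u v : enorm (u - v) <= enorm (u - w) + enorm (w - v).
Proof. by rewrite -[u in leLHS](subrK w) -addrA ler_enormD. Qed.

Lemma le_norm_enorm u : `|u| <= enorm u.
Proof.
rewrite [`|u|]mx_normrE; apply: bigmax_le => [|[i j] _]/=.
  exact: enorm_ge0.
by rewrite ord1 le_coord_enorm.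
Qed.

(** The crude constant [n.+1] is positive even for [n = 0], so radii can be divided by it. *)
Lemma le_enorm_norm u : enorm u <= n.+1%:R * `|u|.
Proof.
have cu i : `|u 0 i| <= `|u|.
  rewrite [`|u|]mx_normrE.
  exact: (le_bigmax _ (fun ij => `|u ij.1 ij.2|) (0, i)).
rewrite -[leRHS]ger0_norm ?mulr_ge0// -sqrtr_sqr ler_wsqrtr//.
apply: (@le_trans _ _ (\sum_(i < n) `|u| ^+ 2)).
  apply: ler_sum => i _; rewrite -expr2 -real_normK ?num_real//.
  by rewrite ler_pXn2r ?nnegrE.
rewrite sumr_const card_ord -[leLHS]mulr_natl exprMn ler_wpM2r ?sqr_ge0//.
by rewrite -natrX ler_nat; apply: (leq_trans (leqnSn n)); exact: leq_pmulr.
Qed.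

Lemma nbhs_enorm x U :
  nbhs x U <-> exists2 e, 0 < e & forall y, enorm (y - x) < e -> U y.
Proof.
split=> [/nbhs_ballP[e /= e0 xeU]|[e e0 xeU]].
  exists e => // y yx; apply: xeU; rewrite -ball_normE /= distrC.
  exact: le_lt_trans (le_norm_enorm _) yx.
apply/nbhs_ballP; exists (e / n.+1%:R) => /=; first by rewrite divr_gt0.
move=> y; rewrite -ball_normE /= distrC => yx; apply: xeU.
by rewrite (le_lt_trans (le_enorm_norm _))// mulrC -ltr_pdivlMr.
Qed.

Lemma nbhs_enorm_lt x e : 0 < e -> nbhs x [set y | enorm (y - x) < e].
Proof. by move=> e0; apply/nbhs_enorm; exists e. Qed.

Lemma cvg_enorm (x_ : nat -> 'rV[R]_n) x :
  (forall i, enorm (x_ i - x) < i.+1%:R^-1) -> x_ @ \oo --> x.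
Proof.
move=> x_lt A /nbhs_enorm[e e0 xeA].
apply: filterS (near_infty_natSinv_lt (PosNum e0)) => i i_lt.
by apply: xeA; exact: lt_trans (x_lt i) i_lt.
Qed.

Lemma enorm_dist_continuous x : continuous (fun y => enorm (y - x)).
Proof.
move=> y A /nbhs_ballP[e /= e0 eA]; apply/nbhs_enorm; exists e => // z zy.
have := ler_enorm_dist z y x; have := ler_enorm_dist y z x.
by rewrite (enormB y z) => ? ?; apply: eA; rewrite /ball/= ltr_norml; lra.
Qed.

Lemma closed_enorm_ge x e : closed [set y | e <= enorm (y - x)].
Proof.
have := @closed_comp _ _ (fun y => enorm (y - x)) [set t | e <= t].
by apply=> [y _|]; [exact: enorm_dist_continuous|exact: closed_ge].
Qed.

Lemma closed_enorm_le x e : closed [set y | enorm (y - x) <= e].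
Proof.
have := @closed_comp _ _ (fun y => enorm (y - x)) [set t | t <= e].
by apply=> [y _|]; [exact: enorm_dist_continuous|exact: closed_le].
Qed.

Lemma compact_enorm_le x e : compact [set y | enorm (y - x) <= e].
Proof.
apply: bounded_closed_compact; last exact: closed_enorm_le.
exists (`|x| + e); split; first exact: num_real.
move=> M eM y /= yx; apply: ltW; apply: le_lt_trans eM.
rewrite -[y in leLHS](subrK x) (le_trans (ler_normD _ _))// addrC lerD2l.
exact: le_trans (le_norm_enorm _) yx.
Qed.

End euclidean.

(** The sublevel sets in [K] are nested, hence a filter base, and compactness gives a cluster point
    [x]. If g y < g x, lower semicontinuity keeps [g] near [x] above a real a >= g y, hence away
    from the sublevel set of [y]. *)
Lemma compact_lsc_argmin {R : realType} (T : topologicalType) (K : set T)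
    (g : T -> \bar R) :
  compact K -> K !=set0 ->
  (forall x a, K x -> (a%:E < g x)%E ->
    \forall y \near x, K y -> (a%:E < g y)%E) ->
  argmin_on K g !=set0.
Proof.
move=> Kcpt [x0 Kx0] g_lsc.
pose sublevel y := [set x | K x /\ (g x <= g y)%E].
have FF : ProperFilter (filter_from K sublevel).
  apply: filter_from_proper => [|y Ky]; last by exists y; split.
  apply: filter_from_filter => [|y z Ky Kz]; first by exists x0.
  by case/orP: (le_total (g y) (g z)) => yz; [exists y|exists z] => // x [? ?];
    split; split=> //; exact: le_trans yz.
have FK : filter_from K sublevel K by exists x0 => // x [].
have [x [Kx x_cluster]] := Kcpt _ FF FK.
exists x; split=> // y Ky; rewrite leNgt; apply/negP => gyx.
have [a gya agx] : exists2 a : R, (g y <= a%:E)%E & (a%:E < g x)%E.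
  case: (g x) (g y) gyx => [r| |] [s| |]//=.
  - by rewrite lte_fin => sr; exists s; rewrite ?lte_fin.
  - by exists (r - 1); rewrite ?lte_fin ?leNye// ltrBlDr ltrDl.
  - by exists s; rewrite ?ltry.
  - by exists 0; rewrite ?leNye ?ltry.
have Fy : filter_from K sublevel (sublevel y) by exists y.
have [z [[Kz zy] /(_ Kz)]] := x_cluster _ _ Fy (g_lsc _ _ Kx agx).
by rewrite ltNge (le_trans zy gya).
Qed.

(** * Tilted functions, subgradients and prox-regularity *)

Section subdifferential.
Context {R : realType} {n : nat}.
Implicit Types (f : 'rV[R]_n -> \bar R) (u v x y xbar : 'rV[R]_n).

Lemma lower_semicontinuous_tilt f v :
  lower_semicontinuous f -> lower_semicontinuous (tilt f v).
Proof.
move=> f_lsc x a; rewrite /tilt => afx.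
have [b ab bfx] : exists2 b, a + dotp v x < b & (b%:E < f x)%E.
  move: afx; case: (f x) => [r| |]//=.
    rewrite -EFinB lte_fin => ar; exists ((a + dotp v x + r) / 2); first lra.
    by rewrite lte_fin; lra.
  by exists (a + dotp v x + 1); rewrite ?ltry//; lra.
have [A xA bA] := f_lsc x b bfx.
(* The [+ 1] covers [v = 0]; within this radius <v, y - x> stays below b - a - <v, x>. *)
pose e := (b - a - dotp v x) / (enorm v + 1).
have v1 : 0 < enorm v + 1 by have := enorm_ge0 v; lra.
have e0 : 0 < e by rewrite divr_gt0//; lra.
exists (A `&` [set y | enorm (y - x) < e]).
  exact: filterI xA (nbhs_enorm_lt x e0).
move=> y [/bA bfy /= yx].
have vyx : dotp v y < b - a.
  have := dotp_le_enorm v (y - x); rewrite dotpE dotpNr => vyx.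
  have : enorm v * enorm (y - x) <= enorm v * e.
    by rewrite ler_wpM2l ?enorm_ge0// ltW.
  have : (enorm v + 1) * e = b - a - dotp v x.
    by rewrite /e mulrC divfK// gt_eqF.
  lra.
move: bfy; case: (f y) => [r| |]//=.
  by rewrite -EFinB !lte_fin; lra.
by rewrite addye// !ltry.
Qed.

Lemma le_tilt f v x y (a : R) : f x \is a fin_num ->
  (tilt f v x + a%:E <= tilt f v y)%E =
  (f x + (dotp v (y - x))%:E + a%:E <= f y)%E.
Proof.
rewrite /tilt dotpDr dotpNr.
case: (f x) (f y) => [r| |] [s| |]//= _; rewrite ?leey ?leeNy_eq//.
by rewrite -!(EFinB, EFinD) !lee_fin; apply/idP/idP; lra.
Qed.

Lemma le_tilt0 f v x y : f x \is a fin_num ->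
  (tilt f v x <= tilt f v y)%E = (f x + (dotp v (y - x))%:E <= f y)%E.
Proof. by move=> fx; have := le_tilt v y 0 fx; rewrite !adde0. Qed.

Lemma tilt0 f x : tilt f 0 x = f x.
Proof. by rewrite /tilt dotp0l sube0. Qed.

(** Here [v] is even a proximal subgradient, since the quadratic term only weakens the inequality,
    and constant sequences make it a limiting one. *)
Lemma tilt_local_minimizer_subdiff f v x : f x \is a fin_num ->
  (\forall y \near x, (tilt f v x <= tilt f v y)%E) -> lim_subdiff f x v.
Proof.
move=> fx x_min; split=> //; exists (fun=> x), (fun=> v).
split; [exact: cvg_cst|exact: cvg_cst|exact: cvg_cst|move=> _].
split=> //; exists 1 => //; apply: filterS x_min => y.
rewrite le_tilt0//; apply: le_trans.
by rewrite -(fineK fx) -!EFinD lee_fin gerBl mul1r sqr_ge0.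
Qed.

Lemma argmin_ball_subdiff f v x xbar (r : R) : f x \is a fin_num ->
  argmin_on [set y | enorm (y - xbar) <= r] (tilt f v) x ->
  enorm (x - xbar) < r -> lim_subdiff f x v.
Proof.
move=> fx [_ x_min] xr; apply: tilt_local_minimizer_subdiff => //.
have r0 : 0 < r - enorm (x - xbar) by rewrite subr_gt0.
apply: filterS (nbhs_enorm_lt x r0) => y /= yx; apply: x_min => /=.
by have := ler_enorm_dist x y xbar; lra.
Qed.

(** Counterexamples chosen at distance below 1/(i+1) turn the sequential notion into a uniform one.
    It supplies the closeness of values that prox-regularity asks for. *)
Lemma subdiff_continuous_near f xbar vbar (eps : R) : 0 < eps ->
  subdiff_continuous f xbar vbar ->
  exists2 e : R, 0 < e & forall x v, lim_subdiff f x v ->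
    enorm (x - xbar) < e -> enorm (v - vbar) < e ->
    (`|f x - f xbar| < eps%:E)%E.
Proof.
move=> eps0 [[fxbar _] f_sdc]; apply: contrapT => no_e.
have ex_xv (i : nat) : exists xv : 'rV[R]_n * 'rV[R]_n,
    [/\ lim_subdiff f xv.1 xv.2, enorm (xv.1 - xbar) < i.+1%:R^-1,
        enorm (xv.2 - vbar) < i.+1%:R^-1 &
        ~ (`|f xv.1 - f xbar| < eps%:E)%E].
  apply: contrapT => no_xv; apply: no_e; exists i.+1%:R^-1 => // x v fxv xi vi.
  by apply: contrapT => far; apply: no_xv; exists (x, v).
have [xv xvP] := choice ex_xv.
have fx_cvg : (f \o (fun i => (xv i).1)) @ \oo --> f xbar.
  apply: f_sdc (fun i => (xv i).2) _ _ _.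
  - by apply: cvg_enorm => i; have [] := xvP i.
  - by apply: cvg_enorm => i; have [] := xvP i.
  - by move=> i; have [] := xvP i.
have [r fr] : exists r, f xbar = r%:E by exists (fine (f xbar)); rewrite fineK.
have [i _ /(_ i (leqnn i))/=] : \forall i \near \oo,
    (`|f (xv i).1 - f xbar| < eps%:E)%E.
  rewrite fr in fx_cvg *; apply: (fx_cvg [set z | (`|z - r%:E| < eps%:E)%E]).
  apply/nbhs_EFin; apply/nbhs_ballP; exists eps => // s.
  by rewrite /ball/= distrC lte_fin.
by have [_ _ _] := xvP i.
Qed.

(** Uniform support is the prox-regularity inequality with [rho = 0]; lower semicontinuity makes the
    truncated sublevel sets closed. *)
Lemma prox_regular_of_uniform_support f xbar (e : R) :
  lower_semicontinuous f -> lim_subdiff f xbar 0 -> 0 < e ->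
  (forall x v y, lim_subdiff f x v -> enorm (x - xbar) < e -> enorm v < e ->
     enorm (y - xbar) < e -> (f x + (dotp v (y - x))%:E <= f y)%E) ->
  prox_regular f xbar 0.
Proof.
move=> f_lsc fx0 e0 f_supp; split=> //; first by case: fx0.
- exists 1 => // a _.
  apply: (@closedI _ [set x | enorm (x - xbar) <= 1] [set x | (f x <= a%:E)%E]).
    exact: closed_enorm_le.
  rewrite -openC.
  rewrite (_ : ~` _ = [set x | (a%:E < f x)%E]).
    by move/lower_semicontinuousP : f_lsc; exact.
  by apply/seteqP; split=> x /=; rewrite ltNge => /negP.
- exists e, 0; split=> // x v fxv; rewrite subr0 => ve xe _ y ye.
  by rewrite !mul0r sube0; exact: f_supp.
Qed.

End subdifferential.

(** * Local maximality of the inverse of a monotone Lipschitz map *)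

Section monotone_inverse.
Context {R : realType} {n : nat}.
Implicit Types (u v w x g : 'rV[R]_n).

(** Step to u - t g, with [t] so small that the point stays in the ball and K t <= 1/2. The value
    then drops by at least t |g|^2 / 2, against minimality unless g = 0. *)
Lemma stationary_interior_min (h : 'rV[R]_n -> R) u g (r K : R) :
  enorm u < r -> 0 < K -> (forall w, enorm w <= r -> h u <= h w) ->
  (forall w, enorm w <= r ->
     h w <= h u + dotp g (w - u) + K * enorm (w - u) ^+ 2) ->
  g = 0.
Proof.
move=> ur K0 h_min h_le; apply: enorm_eq0.
have g0 := enorm_ge0 g.
pose t := Num.min ((r - enorm u) / (enorm g + 1)) (2 * K)^-1.
have t0 : 0 < t.
  by rewrite lt_min divr_gt0 ?subr_gt0 ?invr_gt0 ?mulr_gt0//; lra.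
have tg : t * enorm g <= r - enorm u.
  apply: (@le_trans _ _ (t * (enorm g + 1))).
    by rewrite ler_wpM2l ?ltW//; lra.
  by rewrite -ler_pdivlMr ?ge_min ?lexx//; lra.
have tK : K * t <= 2^-1.
  apply: (@le_trans _ _ (K * (2 * K)^-1)).
    by rewrite ler_pM2l// ge_min lexx orbT.
  by rewrite invfM mulrCA divff ?mulr1// gt_eqF.
have wr : enorm (u - t *: g) <= r.
  apply: le_trans (ler_enormB _ _) _; rewrite enormZ gtr0_norm//; lra.
have := le_trans (h_min _ wr) (h_le _ wr).
rewrite (addrC u) addrK enormN enormZ dotpNr dotpZr -sqr_enorm gtr0_norm//.
have : (K * t) * (t * enorm g ^+ 2) <= 2^-1 * (t * enorm g ^+ 2).
  by rewrite ler_wpM2r// mulr_ge0 ?sqr_ge0 ?ltW.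
move=> Kt le0; have : t * enorm g ^+ 2 <= 0.
  by rewrite exprMn in le0; lra.
rewrite pmulr_rle0// => g2; apply/eqP; rewrite -sqrf_eq0.
by rewrite eq_le g2 sqr_ge0.
Qed.

(* Minty's trick: the inverse of M plus (rho + 1) times the identity is
   locally onto. The resolvent equation u - v = (rho + 1)(x - M u) is solved by
   minimizing the convex function 2(rho + 1) phi u + |u - v|^2, where phi is the
   Fenchel gap F x + F^*(u) - <u, x> written with M as gradient of F^*. *)
Lemma lipschitz_selection_maximal (M : 'rV[R]_n -> 'rV[R]_n)
    (F : 'rV[R]_n -> R) (delta L rho : R) x v :
  0 <= L -> 0 <= rho ->
  (forall u w, enorm u < delta -> enorm w < delta ->
     F (M u) + dotp u (M w - M u) <= F (M w)) ->
  (forall u w, enorm u < delta -> enorm w < delta ->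
     enorm (M u - M w) <= L * enorm (u - w)) ->
  (forall u, enorm u < delta -> F (M u) + dotp u (x - M u) <= F x) ->
  (forall u, enorm u < delta ->
     F x + dotp v (M u - x) - rho / 2 * enorm (M u - x) ^+ 2 <= F (M u)) ->
  enorm v < delta / 4 -> (rho + 1) * enorm (M v - x) < delta / 4 ->
  x = M v.
Proof.
move=> L0 rho0 M_supp M_lip x_supp x_prox v_small Mvx_small.
have delta0 : 0 < delta by have := enorm_ge0 v; lra.
pose c := rho + 1.
have c0 : 0 < c by rewrite /c; lra.
pose phi u := F x - F (M u) - dotp u (x - M u).
(* [phi] is convex with gradient M u - x: this is [M_supp] with [u] and [w] exchanged. *)
have phi_supp u w : enorm u < delta -> enorm w < delta ->
    phi u + dotp (M u - x) (w - u) <= phi w.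
  move=> ud wd; have := M_supp w u wd ud.
  by rewrite /phi !dotpE !(dotpC (M _)) !(dotpC x); lra.
pose h u := 2 * c * phi u + enorm (u - v) ^+ 2.
pose g u : 'rV[R]_n := 2 *: (c *: (M u - x) + (u - v)).
have g_dotp u w : dotp (g u) w = 2 * (c * dotp (M u - x) w + dotp (u - v) w).
  by rewrite /g !dotpE; ring.
have h_supp u w : enorm u < delta -> enorm w < delta ->
    h u + dotp (g u) (w - u) <= h w.
  move=> ud wd; have := phi_supp u w ud wd; have w_u := dotp_ge0 (w - u).
  rewrite -(ler_pM2l c0) => phiuw; rewrite /h !sqr_enorm.
  have -> : dotp (w - v) (w - v) =
      dotp (u - v) (u - v) + 2 * dotp (u - v) (w - u) + dotp (w - u) (w - u).
    by rewrite !dotpE (dotpC w u) (dotpC w v) (dotpC v u); ring.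
  by rewrite g_dotp; lra.
(* The gradient inequality at [w], read backwards, with the Lipschitz bound on [M]: a quadratic
   upper bound for [h]. *)
have h_upper u w : enorm u < delta -> enorm w < delta ->
    h w <= h u + dotp (g u) (w - u) + (2 * c * L + 1) * enorm (w - u) ^+ 2.
  move=> ud wd; have := phi_supp w u wd ud.
  rewrite -(ler_pM2l c0) => phiwu; rewrite /h !sqr_enorm.
  have -> : dotp (w - v) (w - v) =
      dotp (u - v) (u - v) + 2 * dotp (u - v) (w - u) + dotp (w - u) (w - u).
    by rewrite !dotpE (dotpC w u) (dotpC w v) (dotpC v u); ring.
  have : dotp (M w - M u) (w - u) <= L * dotp (w - u) (w - u).
    apply: le_trans (dotp_le_enorm _ _) _; rewrite -sqr_enorm expr2 mulrA.
    by rewrite ler_wpM2r ?enorm_ge0// M_lip.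
  rewrite -(ler_pM2l c0) => Lip.
  have e1 : dotp (M w - x) (u - w) =
      - dotp (M u - x) (w - u) - dotp (M w - M u) (w - u).
    by rewrite !dotpE; ring.
  by rewrite g_dotp; rewrite e1 in phiwu; lra.
have [u [/= ur u_min]] :
    argmin_on [set w | enorm w <= delta / 2] (EFin \o h) !=set0.
  apply: compact_lsc_argmin.
  - have := @compact_enorm_le R n 0 (delta / 2).
    by under eq_set do rewrite subr0.
  - by exists 0; rewrite /= enorm0; lra.
  move=> w a /= wr; rewrite lte_fin => ahw.
  have g1 : 0 < enorm (g w) + 1 by have := enorm_ge0 (g w); lra.
  have e0 : 0 < (h w - a) / (enorm (g w) + 1) by rewrite divr_gt0 ?subr_gt0.
  apply: filterS (nbhs_enorm_lt w e0) => z /= zw zr; rewrite lte_fin.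
  have wd : enorm w < delta by lra.
  have zd : enorm z < delta by lra.
  have := h_supp _ _ wd zd.
  have := dotp_le_enorm (g w) (w - z); rewrite enormB -opprB dotpNr.
  have : (enorm (g w) + 1) * enorm (z - w) < h w - a.
    by rewrite mulrC -ltr_pdivlMr.
  have := enorm_ge0 (z - w); lra.
have ud : enorm u < delta by lra.
have vd : enorm v < delta by lra.
(* The minimizer is interior: as phi u >= 0, |u - v|^2 <= h u <= h v = 2 c phi v, and
   prox-regularity bounds this by c rho |M v - x|^2 <= (c |M v - x|)^2. *)
have uv : enorm (u - v) < delta / 4.
  have hvr : enorm v <= delta / 2 by lra.
  have := u_min _ hvr; rewrite /= lee_fin /h subrr enorm0 expr0n addr0 => huv.
  have phiu0 : 0 <= phi u by have := x_supp u ud; rewrite /phi; lra.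
  have phiv : phi v <= rho / 2 * enorm (M v - x) ^+ 2.
    have := x_prox v vd; rewrite /phi -(opprB (M v)) dotpNr; lra.
  apply: le_lt_trans Mvx_small.
  rewrite -(@ler_pXn2r _ 2)// ?nnegrE ?mulr_ge0 ?enorm_ge0//; last lra.
  have cphiu : 0 <= c * phi u by rewrite mulr_ge0// ltW.
  have : c * phi v <= c * (rho / 2 * enorm (M v - x) ^+ 2) by rewrite ler_pM2l.
  have : c * rho * enorm (M v - x) ^+ 2 <= c * c * enorm (M v - x) ^+ 2.
    by rewrite ler_wpM2r ?sqr_ge0// ler_pM2l// /c; lra.
  rewrite exprMn -/c; lra.
have {}ur : enorm u < delta / 2.
  by have := ler_enormD (u - v) v; rewrite subrK; lra.
have gu0 : g u = 0.
  apply: (@stationary_interior_min h u (g u) (delta / 2) (2 * c * L + 1)) => //.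
  - by have : 0 <= c * L; [rewrite mulr_ge0// ltW|lra].
  - by move=> w wr; apply: h_upper => //; lra.
have u_v : u - v = c *: (x - M u).
  apply/eqP; rewrite -subr_eq0 -scalerN opprB addrC.
  by move/eqP: gu0; rewrite scaler_eq0 pnatr_eq0.
(* Adding [x_supp] and [x_prox] gives <u - v, x - M u> <= (rho / 2) |x - M u|^2, while the left side
   is (rho + 1) |x - M u|^2. *)
have xMu : x = M u.
  apply/eqP; rewrite -subr_eq0; apply/eqP/enorm_eq0.
  have := x_supp u ud; have := x_prox u ud.
  have : dotp (u - v) (x - M u) = c * enorm (x - M u) ^+ 2.
    by rewrite u_v dotpZl sqr_enorm.
  rewrite (enormB (M u)) -(opprB x (M u)) dotpNr dotpDl dotpNl.
  move=> u_vE prox supp.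
  apply/eqP; rewrite -sqrf_eq0 eq_le sqr_ge0 andbT.
  have : (rho / 2 + 1) * enorm (x - M u) ^+ 2 <= 0 by rewrite /c in u_vE; lra.
  by rewrite pmulr_rle0//; lra.
by move: u_v; rewrite {1}xMu subrr scaler0 => /eqP; rewrite subr_eq0 => /eqP <-.
Qed.

End monotone_inverse.

(** * The implications between the four properties *)

Section equivalences.
Context {R : realType} {n : nat} (f : 'rV[R]_n -> \bar R) (xbar : 'rV[R]_n).
Implicit Types (u v w x y : 'rV[R]_n).

(** The strong minimizers m v form a Lipschitz selection to which [lipschitz_selection_maximal]
    applies, with [F] the real part of [f]. Hence a nearby subgradient [v] occurs only at m v. *)
Lemma localized_inverse_subdiff :
  prox_regular f xbar 0 -> subdiff_continuous f xbar 0 ->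
  stable_strong_local_minimizer f xbar ->
  exists (kappa e : R) (m : 'rV[R]_n -> 'rV[R]_n),
    [/\ 0 < kappa, 0 < e, m 0 = xbar,
        forall v w, enorm v < e -> enorm w < e ->
          2 * kappa * enorm (m v - m w) <= enorm (v - w) &
        forall x v, enorm (x - xbar) < e -> enorm v < e ->
          (lim_subdiff f x v <-> x = m v) /\
          (f (m v) + (dotp v (x - m v))%:E
             + (kappa * enorm (x - m v) ^+ 2)%:E <= f x)%E].
Proof.
move=> [_ _ _ [eps [rho [eps0 rho0 f_prox]]]] f_sdc.
move=> [fxbar [kappa [U [kappa0 /nbhs_enorm[eU eU0 eU_sub] [m [m0 near0]]]]]].
have [d d0 d_min] : exists2 d, 0 < d & forall v, enorm v < d -> U (m v) /\
    forall x, U x -> (tilt f v (m v) + (kappa * enorm (x - m v) ^+ 2)%:E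
      <= tilt f v x)%E.
  by have [d d0 dP] := iffLR (nbhs_enorm _ _) near0; exists d => // v vd;
    apply: dP; rewrite subr0.
have Uxbar : U xbar by apply: eU_sub; rewrite subrr enorm0.
have fmin x : U x -> (f xbar <= f x)%E.
  have d00 : enorm (0 : 'rV[R]_n) < d by rewrite enorm0.
  have [_ /(_ x)] := d_min _ d00; rewrite m0 !tilt0 => /[apply].
  by apply: le_trans; rewrite leeDl// lee_fin mulr_ge0 ?sqr_ge0 ?ltW.
(* [fmin] rules out the value -oo, and comparison with [xbar] rules out +oo. *)
have fm v : enorm v < d -> f (m v) \is a fin_num.
  move=> vd; have [Um /(_ _ Uxbar)] := d_min v vd.
  have := fmin _ Um; move: fxbar; rewrite /tilt.
  by case: (f xbar) => // r _; case: (f (m v)).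
pose F x := fine (f x).
have f_growth v x : enorm v < d -> U x ->
    (f (m v) + (dotp v (x - m v))%:E
       + (kappa * enorm (x - m v) ^+ 2)%:E <= f x)%E.
  move=> vd Ux; have [_ /(_ _ Ux)] := d_min v vd.
  by rewrite le_tilt// fm.
have F_growth v x : enorm v < d -> U x -> f x \is a fin_num ->
    F (m v) + dotp v (x - m v) + kappa * enorm (x - m v) ^+ 2 <= F x.
  move=> vd Ux fx; have := f_growth v x vd Ux.
  by rewrite -(fineK fx) -(fineK (fm v vd)) -!EFinD lee_fin.
(* Add the growth inequalities at m v and m w, apply Cauchy-Schwarz, and cancel one factor |m v - m
   w|. *)
have m_lip v w : enorm v < d -> enorm w < d ->
    2 * kappa * enorm (m v - m w) <= enorm (v - w).
  move=> vd wd.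
  have := F_growth v (m w) vd (proj1 (d_min w wd)) (fm w wd).
  have := F_growth w (m v) wd (proj1 (d_min v vd)) (fm v vd).
  rewrite (enormB (m w)); set D := enorm (m v - m w).
  have := dotp_le_enorm (v - w) (m v - m w); rewrite -/D.
  have -> : dotp (v - w) (m v - m w) =
      - dotp v (m w - m v) - dotp w (m v - m w) by rewrite !dotpE; ring.
  move=> ? ? ?; have : 2 * kappa * D ^+ 2 <= enorm (v - w) * D by lra.
  have [-> _|D0] := eqVneq D 0; first by rewrite mulr0 enorm_ge0.
  by rewrite expr2 mulrA ler_pM2r// lt0r D0; exact: enorm_ge0.
have m_near v r : enorm v < d -> enorm v < 2 * kappa * r ->
    enorm (m v - xbar) < r.
  move=> vd vr; have := m_lip v 0 vd; rewrite enorm0 m0 subr0 => /(_ d0) mv.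
  rewrite -(@ltr_pM2l _ (2 * kappa)) ?mulr_gt0//.
  exact: le_lt_trans mv vr.
have [eC eC0 f_near] := subdiff_continuous_near eps0 f_sdc.
(* For |u| < delta, m u is within [eps] of [xbar], so prox-regularity can be tested there. *)
pose delta := Num.min d (2 * kappa * eps).
have delta0 : 0 < delta by rewrite lt_min d0 !mulr_gt0.
have k0 : 0 < 2 * kappa by rewrite mulr_gt0.
pose c := rho + 1.
have c0 : 0 < c by rewrite /c; lra.
(* The last two bounds put [x] and m v within delta / (8 c) of [xbar], so that c |m v - x| < delta /
   4. The bound 2 kappa eU puts m v inside [U]; [eC] and [eps] make prox-regularity available at (x,
   v). *)
have [e [e0 [eeU eeC eeps] ed [eU' ec eck]]] : exists e : R,
    [/\ 0 < e, [/\ e < eU, e < eC & e < eps], e < delta / 4 &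
     [/\ e < 2 * kappa * eU, e < delta / 8 / c &
         e < 2 * kappa * (delta / 8 / c)]].
  have ? : 0 < 2 * kappa * eU by rewrite mulr_gt0.
  have ? : 0 < delta / 8 / c by rewrite !divr_gt0.
  have ? : 0 < 2 * kappa * (delta / 8 / c) by rewrite mulr_gt0.
  have : \forall e \near 0^'+, [/\ 0 < e, [/\ e < eU, e < eC & e < eps],
     e < delta / 4 &
     [/\ e < 2 * kappa * eU, e < delta / 8 / c &
         e < 2 * kappa * (delta / 8 / c)]].
    near=> e; split; [by []| | |split].
    - split; near: e; exact: nbhs_right_lt.
    - near: e; apply: nbhs_right_lt; lra.
    - near: e; exact: nbhs_right_lt.
    - near: e; exact: nbhs_right_lt.
    - near: e; exact: nbhs_right_lt.
  by move=> /filter_ex.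
have delta_d : delta <= d by rewrite ge_min lexx.
have delta_eps : delta <= 2 * kappa * eps by rewrite ge_min lexx orbT.
exists kappa, e, m; split=> // [v w ve we|x v xe ve].
  by apply: m_lip; lra.
have vd : enorm v < d by lra.
have Ux : U x by apply: eU_sub; lra.
split; last exact: f_growth.
split=> [fxv|->].
- have fx : f x \is a fin_num by case: fxv.
  have f_near_x : (`|f x - f xbar| < eps%:E)%E.
    by apply: (f_near x v) => //; rewrite ?subr0; lra.
  apply: (@lipschitz_selection_maximal R n m F delta (2 * kappa)^-1 rho) => //.
  + by rewrite invr_ge0 ltW.
  + move=> u w ud wd; have ud' : enorm u < d by lra.
    have wd' : enorm w < d by lra.
    have := F_growth u (m w) ud' (proj1 (d_min w wd')) (fm w wd').
    have := mulr_ge0 (ltW kappa0) (sqr_ge0 (enorm (m w - m u))); lra.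
  + move=> u w ud wd; rewrite ler_pdivlMl//; apply: m_lip; lra.
  + move=> u ud; have ud' : enorm u < d by lra.
    have := F_growth u x ud' Ux fx.
    have := mulr_ge0 (ltW kappa0) (sqr_ge0 (enorm (x - m u))); lra.
  + move=> u ud; have ud' : enorm u < d by lra.
    rewrite -lee_fin /F (fineK (fm u ud')).
    have mu : enorm (m u - xbar) < eps by apply: m_near; lra.
    have := f_prox x v fxv; rewrite subr0.
    move=> /(_ (lt_trans ve eeps) (lt_trans xe eeps) f_near_x _ mu).
    by rewrite -{1}(fineK fx) -!EFinD.
  + by lra.
  + have mv : enorm (m v - xbar) < delta / 8 / c by apply: m_near => //; lra.
    have : enorm (m v - x) < delta / 4 / c.
      by have := ler_enorm_dist xbar (m v) x; rewrite (enormB xbar x); lra.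
    by rewrite ltr_pdivlMr// mulrC.
- apply: tilt_local_minimizer_subdiff; first exact: fm.
  have mv : enorm (m v - xbar) < eU by apply: m_near => //; lra.
  have mvU : 0 < eU - enorm (m v - xbar) by rewrite subr_gt0.
  apply: filterS (nbhs_enorm_lt (m v) mvU) => y /= ym.
  have Uy : U y by apply: eU_sub; have := ler_enorm_dist (m v) y xbar; lra.
  have [_ /(_ y Uy)] := d_min v vd; apply: le_trans.
  have tm : tilt f v (m v) \is a fin_num by rewrite /tilt fin_numB fm.
  by rewrite leeDl// lee_fin mulr_ge0 ?sqr_ge0 ?ltW.
Unshelve. all: by end_near. Qed.


(** This is the duality between a Lipschitz gradient of the conjugate and strong convexity:
    Lipschitz constant K yields growth constant 1/(4K). *)
Lemma tilt_stable_stable_strong_local_minimizer :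
  tilt_stable f xbar -> stable_strong_local_minimizer f xbar.
Proof.
move=> [fxbar [eps eps0 [M0 [V /nbhs_enorm[d d0 dV] [M_sv [L M_lip]]]]]].
split=> //; pose M v := argmin_on [set x | enorm (x - xbar) <= eps] (tilt f v).
have {dV} Vd v : enorm v < d -> V v by move=> vd; apply: dV; rewrite subr0.
have [xbarB fmin] : M 0 xbar by rewrite /M M0.
have {}fmin x : enorm (x - xbar) <= eps -> (f xbar <= f x)%E.
  by move=> xB; have := fmin x xB; rewrite !tilt0.
pose m v := get (M v).
have Mm v : enorm v < d -> M v (m v).
  by move=> vd; have [y [My _]] := M_sv v (Vd v vd); apply: getI My.
have m0 : m 0 = xbar.
  by have := Mm 0; rewrite enorm0 => /(_ d0); rewrite /M M0.
(* [L] may be zero or negative, and the argument divides by the constant. *)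
pose K := Num.max L 1.
have K1 : 1 <= K by rewrite le_max lexx orbT.
have m_lip v w : enorm v < d -> enorm w < d ->
    enorm (m v - m w) <= K * enorm (v - w).
  move=> vd wd; apply: le_trans (_ : L * enorm (v - w) <= _).
    exact: M_lip (Vd _ vd) (Vd _ wd) (Mm _ vd) (Mm _ wd).
  by rewrite ler_wpM2r ?enorm_ge0// le_max lexx.
have fm v : enorm v < d -> f (m v) \is a fin_num.
  move=> vd; have [mB /(_ _ xbarB)] := Mm v vd.
  have := fmin _ mB; move: fxbar; rewrite /tilt.
  by case: (f xbar) => // r _; case: (f (m v)).
have m_supp v x : enorm v < d -> enorm (x - xbar) <= eps ->
    (f (m v) + (dotp v (x - m v))%:E <= f x)%E.
  by move=> vd xB; have [_ /(_ x xB)] := Mm v vd; rewrite le_tilt0// fm.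
have K0 : 0 < K by lra.
have Kd0 : 0 < K * d by rewrite mulr_gt0.
(* As |m v - xbar| < r / 2, the bound r <= K d / 2 gives |x - m v| / (2K) <= 3 d / 8 below, which
   keeps the auxiliary tilt [w] in the ball of radius [d]. *)
pose r := Num.min eps (K * d / 2).
have r0 : 0 < r by rewrite lt_min eps0/= divr_gt0// mulr_gt0.
have r_eps : r <= eps by rewrite ge_min lexx.
have r_Kd : r <= K * d / 2 by rewrite ge_min lexx orbT.
exists (4 * K)^-1, [set x | enorm (x - xbar) < r]; split.
- by rewrite invr_gt0 mulr_gt0.
- exact: nbhs_enorm_lt.
exists m; split=> //; apply/nbhs_enorm; exists (r / (2 * K)).
  by rewrite divr_gt0// mulr_gt0.
move=> v; rewrite subr0 ltr_pdivlMr ?mulr_gt0// => vr.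
have vd2 : enorm v < d / 2.
  rewrite -(ltr_pM2r (_ : 0 < 2 * K)) ?mulr_gt0//; apply: lt_le_trans vr _; lra.
have vd : enorm v < d by lra.
have d00 : enorm (0 : 'rV[R]_n) < d by rewrite enorm0.
have mv : enorm (m v - xbar) < r / 2.
  have := m_lip v 0 vd d00; rewrite m0 subr0; lra.
split=> [|x /= xr]; first by rewrite /=; lra.
rewrite le_tilt ?fm//.
(* Combine the supporting inequalities at m v and at m w, where w - v is the
   displacement x - m v scaled by the optimal factor 1/(2K). *)
pose w := v + (2 * K)^-1 *: (x - m v).
have w_v : w - v = (2 * K)^-1 *: (x - m v) by rewrite /w addrC addKr.
have wd : enorm w < d.
  have wv : enorm w <= enorm v + (2 * K)^-1 * enorm (x - m v).
    apply: le_trans (ler_enormD _ _) _.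
    by rewrite enormZ gtr0_norm// invr_gt0 mulr_gt0.
  have := ler_enorm_dist xbar x (m v); rewrite (enormB xbar) => xm.
  suff : (2 * K)^-1 * enorm (x - m v) <= 3 / 8 * d by lra.
  rewrite ler_pdivrMl ?mulr_gt0//; lra.
apply: le_trans (m_supp w x wd _); last by move: xr r_eps; lra.
have := m_supp v (m w) vd (proj1 (Mm w wd)).
rewrite -(fineK (fm v vd)) -(fineK (fm w wd)) -!EFinD !lee_fin => supp_v.
set D := enorm (x - m v).
have w_vx : dotp (w - v) (x - m v) = (2 * K)^-1 * D ^+ 2.
  by rewrite w_v dotpZl sqr_enorm.
have w_vm : dotp (w - v) (m w - m v) <= (4 * K)^-1 * D ^+ 2.
  apply: le_trans (dotp_le_enorm _ _) _.
  apply: le_trans (_ : enorm (w - v) * (K * enorm (w - v)) <= _).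
    by rewrite ler_wpM2l ?enorm_ge0// m_lip.
  rewrite w_v enormZ gtr0_norm ?invr_gt0 ?mulr_gt0// -/D.
  by rewrite le_eqVlt; apply/orP; left; apply/eqP; field; rewrite gt_eqF.
have half : (2 * K)^-1 * D ^+ 2 = 2 * ((4 * K)^-1 * D ^+ 2).
  by field; rewrite gt_eqF.
move: w_vx w_vm; rewrite !dotpE in supp_v *; rewrite half; lra.
Qed.

(** The conclusion keeps both the Lipschitz property and the growth, so that it serves two
    implications of the cycle. *)
Lemma stable_strong_uniform_growth :
  prox_regular f xbar 0 -> subdiff_continuous f xbar 0 ->
  stable_strong_local_minimizer f xbar ->
  exists (kappa : R) (U V : set 'rV[R]_n),
    [/\ 0 < kappa, nbhs xbar U, nbhs (0 : 'rV[R]_n) V,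
        lipschitz_map_on V
          (localization (inverse_map (lim_subdiff f)) V U) &
        forall xt vt, U xt -> V vt -> lim_subdiff f xt vt ->
          forall x, U x ->
            (f x >= f xt + (dotp vt (x - xt))%:E
                    + (kappa * enorm (x - xt) ^+ 2)%:E)%E].
Proof.
move=> f_prox f_sdc f_strong.
have [kappa [e [m [kappa0 e0 m0 m_lip mP]]]] :=
  localized_inverse_subdiff f_prox f_sdc f_strong.
pose U := [set x : 'rV[R]_n | enorm (x - xbar) < e].
(* The second bound forces m v into [U], so over [V] the localization is exactly the graph of
   [m]. *)
pose V := [set v : 'rV[R]_n | enorm v < e /\ enorm v < 2 * kappa * e].
have k0 : 0 < 2 * kappa by rewrite mulr_gt0.
have Um v : V v -> U (m v).
  move=> [ve vke]; have := m_lip v 0 ve; rewrite enorm0 m0 subr0 => /(_ e0) mv.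
  by rewrite /U /= -(ltr_pM2l k0); exact: le_lt_trans mv vke.
have locE v x : localization (inverse_map (lim_subdiff f)) V U v x <->
    V v /\ x = m v.
  split=> [[Vv Ux fxv]|[Vv ->]].
    by split=> //; apply/(proj1 (mP x v Ux (proj1 Vv))).
  split=> //; first exact: Um.
  by apply/(proj1 (mP (m v) v (Um v Vv) (proj1 Vv))).
exists kappa, U, V; split=> //.
- exact: nbhs_enorm_lt.
- apply/nbhs_enorm; exists (Num.min e (2 * kappa * e)).
    by rewrite lt_min e0 mulr_gt0.
  by move=> v; rewrite subr0 lt_min => /andP[].
- split=> [v Vv|].
    exists (m v); split; first exact/locE.
    by move=> x /locE[].
  exists (2 * kappa)^-1 => v w x y [ve _] [we _] /locE[_ ->] /locE[_ ->].
  by rewrite ler_pdivlMl// m_lip.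
- move=> xt vt Uxt [ve _] fxv x Ux.
  have /(proj1 (mP xt vt Uxt ve)) -> := fxv.
  exact: (mP x vt Ux ve).2.
Qed.

(** Growth implies uniform support, hence prox-regularity. The unique point of the localization over
    [v] serves as the strong minimizer; uniqueness makes it [xbar] at 0. *)
Lemma uniform_growth_stable_strong (kappa : R) (U V : set 'rV[R]_n) :
  lower_semicontinuous f -> lim_subdiff f xbar 0 -> 0 < kappa ->
  nbhs xbar U -> nbhs (0 : 'rV[R]_n) V ->
  single_valued_on V (localization (inverse_map (lim_subdiff f)) V U) ->
  (forall xt vt, U xt -> V vt -> lim_subdiff f xt vt -> forall x, U x ->
     (f x >= f xt + (dotp vt (x - xt))%:E
             + (kappa * enorm (x - xt) ^+ 2)%:E)%E) ->
  prox_regular f xbar 0 /\ stable_strong_local_minimizer f xbar.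
Proof.
move=> f_lsc f0 kappa0 xbarU V0 loc_sv f_growth.
have fxbar : f xbar \is a fin_num by case: f0.
split.
  have [eU eU0 eU_sub] := iffLR (nbhs_enorm _ _) xbarU.
  have [eV eV0 eV_sub] := iffLR (nbhs_enorm _ _) V0.
  apply: (@prox_regular_of_uniform_support _ _ _ _ (Num.min eU eV)) => //.
    by rewrite lt_min eU0.
  move=> x v y fxv; rewrite !lt_min => /andP[xU _] /andP[_ vV] /andP[yU _].
  have Vv : V v by apply: eV_sub; rewrite subr0.
  apply: le_trans (f_growth x v (eU_sub x xU) Vv fxv y (eU_sub y yU)).
  have fx : f x \is a fin_num by case: fxv.
  by rewrite leeDl// lee_fin mulr_ge0 ?sqr_ge0 ?ltW.
split=> //; exists kappa, U; split=> //.
pose loc := localization (inverse_map (lim_subdiff f)) V U.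
exists (fun v => get (loc v)); split.
  have [y [_ y_uniq]] := loc_sv 0 (nbhs_singleton V0).
  have xbar_loc : loc 0 xbar.
    by split=> //; [exact: nbhs_singleton V0|exact: nbhs_singleton xbarU].
  by rewrite -(y_uniq _ xbar_loc); apply/esym/y_uniq; exact: getI xbar_loc.
apply: filterS V0 => v Vv; have [y [y_loc _]] := loc_sv v Vv.
have [_ Um fmv] : loc v (get (loc v)) by exact: getI y_loc.
split=> // x Ux; rewrite le_tilt; last by case: fmv.
exact: f_growth.
Qed.


Lemma strongly_metrically_regular_tilt_stable :
  lower_semicontinuous f -> local_minimizer f xbar ->
  strongly_metrically_regular (lim_subdiff f) xbar 0 ->
  prox_regular f xbar 0 /\ tilt_stable f xbar.
Proof.
move=> f_lsc xbar_min [f0 [U [V [xbarU V0 [loc_sv [L loc_lip]]]]]].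
have fxbar : f xbar \is a fin_num by case: f0.
have [s s0 sP] := iffLR (nbhs_enorm _ _) (filterI xbarU xbar_min).
have [eV eV0 eV_sub] := iffLR (nbhs_enorm _ _) V0.
have {}eV_sub v : enorm v < eV -> V v.
  by move=> ve; apply: eV_sub; rewrite subr0.
have uniq v x y : V v -> U x -> U y -> lim_subdiff f x v ->
    lim_subdiff f y v -> x = y.
  move=> Vv Ux Uy fxv fyv; have [z [_ z_uniq]] := loc_sv v Vv.
  by rewrite -(z_uniq x) ?(z_uniq y).
(* A nearby point with the value f xbar is itself a local minimizer, so 0 is a subgradient there and
   uniqueness applies. *)
have strict x : enorm (x - xbar) < s -> f x = f xbar -> x = xbar.
  move=> xs fx; apply: (@uniq 0) => //; try exact: nbhs_singleton.
    exact: (sP x xs).1.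
  apply: tilt_local_minimizer_subdiff; first by rewrite fx.
  have sx : 0 < s - enorm (x - xbar) by rewrite subr_gt0.
  apply: filterS (nbhs_enorm_lt x sx) => y /= yx.
  by rewrite !tilt0 fx; apply: (sP y _).2; have := ler_enorm_dist x y xbar; lra.
pose r := s / 2; have r0 : 0 < r by rewrite divr_gt0.
pose B := [set x : 'rV[R]_n | enorm (x - xbar) <= r].
have rs : r < s by rewrite /r; lra.
have BU x : B x -> U x.
  by move=> Bx; apply: (sP x _).1; exact: le_lt_trans Bx rs.
have Bmin x : B x -> (f xbar <= f x)%E.
  by move=> Bx; apply: (sP x _).2; exact: le_lt_trans Bx rs.
have Bxbar : B xbar by rewrite /B/= subrr enorm0 ltW.
have [c c0 f_sphere] : exists2 c : R, 0 < c & forall x, enorm (x - xbar) = r ->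
    (f xbar + c%:E <= f x)%E.
  pose S := B `&` [set x | r <= enorm (x - xbar)].
  (* The sphere is empty in dimension 0, and then any [c] will do. *)
  have [[x0 Sx0]|S0] := pselect (S !=set0); last first.
    exists 1 => // x xr; exfalso; apply: S0; exists x.
    by split; rewrite /B /= xr.
  have [x [[/= Bx rx] x_min]] : argmin_on S f !=set0.
    apply: compact_lsc_argmin; [|by exists x0|].
      apply: compact_closedI; [exact: compact_enorm_le|].
      exact: closed_enorm_ge.
    move=> x a _ /(f_lsc x a)[A xA aA].
    by apply: filterS xA => y Ay _; exact: aA.
  have fx : (f xbar < f x)%E.
    rewrite lt_def (Bmin _ Bx) andbT; apply/eqP => /strict xE.
    by move: rx; rewrite xE ?subrr ?enorm0//; [lra|exact: le_lt_trans Bx rs].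
  have [c c0 fcx] : exists2 c : R, 0 < c & (f xbar + c%:E <= f x)%E.
    move: fxbar fx; case: (f xbar) => // p _; case: (f x) => [q| |]//=.
      rewrite lte_fin => pq; exists (q - p); first by rewrite subr_gt0.
      by rewrite -EFinD lee_fin; lra.
    by exists 1; rewrite ?leey.
  exists c => // y yr; apply: le_trans fcx (x_min y _).
  by split; rewrite /B /= yr.
pose M v := argmin_on B (tilt f v).
have M_ex v : M v !=set0.
  apply: compact_lsc_argmin; [exact: compact_enorm_le|by exists xbar|].
  move=> x a _ /(lower_semicontinuous_tilt f_lsc)[A xA aA].
  by apply: filterS xA => y Ay _; exact: aA.
(* On the sphere a tilt with |v| < c / r changes the value relative to [xbar] by less than [c], so
   no minimizer of the tilted function lies there. *)
pose d := Num.min eV (c / r).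
have d0 : 0 < d by rewrite lt_min eV0 divr_gt0.
have MU v x : enorm v < d -> M v x -> [/\ V v, U x & lim_subdiff f x v].
  rewrite lt_min => /andP[/eV_sub Vv vc] Mvx; have [Bx x_min] := Mvx.
  split=> //; first exact: BU.
  have fx : f x \is a fin_num.
    have := Bmin x Bx; have := x_min xbar Bxbar; rewrite /tilt.
    by move: fxbar; case: (f xbar) => // p _; case: (f x).
  apply: (argmin_ball_subdiff fx Mvx); rewrite lt_neqAle [_ <= _]Bx andbT.
  apply/eqP => xr; have := f_sphere x xr; have := x_min xbar Bxbar.
  rewrite le_tilt0// -(fineK fx) -(fineK fxbar) -!EFinD !lee_fin.
  rewrite -(opprB x xbar) dotpNr => ? ?.
  have := dotp_le_enorm v (x - xbar); rewrite xr.
  by rewrite ltr_pdivlMr// in vc; lra.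
split.
  have [ed er] : Num.min d r <= d /\ Num.min d r <= r.
    by split; rewrite ge_min lexx ?orbT.
  apply: (@prox_regular_of_uniform_support _ _ _ _ (Num.min d r)) => //.
    by rewrite lt_min d0.
  move=> x v y fxv /lt_le_trans/(_ er) xr /lt_le_trans/(_ ed) vd.
  move=> /lt_le_trans/(_ er) yr.
  (* The tilted minimizer [z] has the same subgradient [v] as [x], so z = x, and minimality of [z]
     is support at [x]. *)
  have [z Mz] := M_ex v; have [Vv Uz fzv] := MU v z vd Mz.
  have zx : z = x by apply: (uniq v) => //; apply: BU; exact: ltW.
  have [_ /(_ y (ltW yr))] := Mz; rewrite zx le_tilt0//.
  by case: fxv.
have xbar_uniq x : M 0 x -> x = xbar.
  move=> /MU; rewrite enorm0 => /(_ d0)[V0' Ux fx0].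
  by apply: (uniq 0) => //; exact: nbhs_singleton.
split=> //; exists r => //; split.
  apply/seteqP; split=> x; first exact: xbar_uniq.
  by move=> ->; have [z Mz] := M_ex 0; have := Mz; rewrite (xbar_uniq z Mz).
exists [set v | enorm v < d].
  by apply/nbhs_enorm; exists d => // v; rewrite subr0.
split=> [v /= vd|].
  have [x Mx] := M_ex v; exists x; split=> // y My.
  have [Vv Ux fxv] := MU v x vd Mx; have [_ Uy fyv] := MU v y vd My.
  exact: (uniq v).
exists L => v w x y vd wd Mx My; have [Vv Ux fxv] := MU v x vd Mx.
have [Vw Uy fyw] := MU w y wd My.
by apply: loc_lip.
Qed.

End equivalences.

Theorem theorem3p3 (R : realType) (n : nat) (f : 'rV[R]_n -> \bar R)
    (xbar : 'rV[R]_n)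
    (f_lsc : lower_semicontinuous f)
    (xbar_min : local_minimizer f xbar)
    (f_sdc : subdiff_continuous f xbar 0) :
  [<-> strongly_metrically_regular (lim_subdiff f) xbar 0;
       prox_regular f xbar 0 /\ tilt_stable f xbar;
       exists (kappa : R) (U V : set 'rV[R]_n),
         [/\ 0 < kappa, nbhs xbar U, nbhs (0 : 'rV[R]_n) V,
             single_valued_on V (localization (inverse_map (lim_subdiff f)) V U) &
             forall xt vt, U xt -> V vt -> lim_subdiff f xt vt ->
               forall x, U x ->
                 (f x >= f xt + (dotp vt (x - xt))%:E
                         + (kappa * enorm (x - xt) ^+ 2)%:E)%E];
       prox_regular f xbar 0 /\ stable_strong_local_minimizer f xbar].
Proof.
have f0 : lim_subdiff f xbar 0 by case: f_sdc.
tfae.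
- exact: strongly_metrically_regular_tilt_stable.
- move=> [f_prox /tilt_stable_stable_strong_local_minimizer f_strong].
  have [kappa [U [V [? ? ? [? _] ?]]]] :=
    stable_strong_uniform_growth f_prox f_sdc f_strong.
  by exists kappa, U, V.
- move=> [kappa [U [V [kappa0 xbarU V0 loc_sv f_growth]]]].
  exact: uniform_growth_stable_strong loc_sv f_growth.
(* The cycle closes by keeping the Lipschitz localization and discarding the growth. *)
- move=> [f_prox f_strong]; split=> //.
  have [_ [U [V [_ ? ? ? _]]]] :=
    stable_strong_uniform_growth f_prox f_sdc f_strong.
  by exists U, V.
Qed.
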